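(* Each of the moves $\Delta$, $\mathrm{BP}$, $\mathrm{F}$, $\mathrm{VC}$ and $\mathrm{wBP}$ is an unknotting operation on welded long knots, and hence on welded knots: for each $\mu$ among these five moves, every Gauss diagram on one interval (respectively, on one circle) can be transformed into the diagram with no arrow by a finite sequence of welded Reidemeister moves and $\mu$ moves.
   Context: A Gauss diagram on one interval (resp. one circle), oriented and called the strand, is a finite set of signed arrows (tail, head, sign $\pm1$), all endpoints being distinct points of the strand, up to orientation-preserving homeomorphisms. Welded long knots (resp. welded knots) are Gauss diagrams on one interval (resp. one circle) up to welded Reidemeister moves. Endpoints are adjacent if no other endpoint lies between them. Moves are used in both directions; portions of the strand below are disjoint, contain only the mentioned endpoints, and occur in any order and with any orientation. Welded Reidemeister moves: (R1) insert or delete an arrow of any sign with adjacent endpoints; (R2) insert or delete two arrows with opposite signs whose tails are adjacent on one portion and whose heads are adjacent on another; (R3) given portions $s_1,s_2,s_3$ containing exactly the endpoints of arrows $s_1\to s_2$, $s_2\to s_3$, $s_1\to s_3$ with signs $\varepsilon_{12},\varepsilon_{23},\varepsilon_{13}$, exchange the two endpoints on each portion, provided $\varepsilon_{12}\eta_1\eta_2=\varepsilon_{23}\eta_2\eta_3=-\varepsilon_{13}\eta_1\eta_3$, where $\eta_k=+1$ if along the orientation the endpoint on $s_k$ of the arrow joining $s_k$ and $s_{k-1}$ precedes that of the arrow joining $s_k$ and $s_{k+1}$ (indices mod 3), and $-1$ otherwise; (OC) exchange two adjacent tails. Local moves. $\mathrm{F}$: exchange an adjacent tail and head of two distinct arrows.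 $\mathrm{VC}$: reverse the direction of an arrow, keeping its sign. $\mathrm{SR}$: change the sign of an arrow, keeping its direction. $\Delta$: given portions $s_1,s_2,s_3$ containing exactly the endpoints of arrows $s_1\to s_2$, $s_2\to s_3$, $s_3\to s_1$ with signs $\varepsilon_{12},\varepsilon_{23},\varepsilon_{31}$, exchange the two endpoints on each portion, provided $\varepsilon_{12}\eta_1\eta_2=\varepsilon_{23}\eta_2\eta_3=\varepsilon_{31}\eta_3\eta_1$, with $\eta_k$ as in R3. $\mathrm{BP}$: given portions $s_1,\dots,s_4$ containing exactly the endpoints of four arrows, one from $s_i$ to $s_j$ with sign $\varepsilon_{ij}$ for each $i\in\{1,2\}$, $j\in\{3,4\}$, reverse direction and change sign of all four, provided $\varepsilon_{ij}\eta_i\eta_j$ is the same for all four pairs, where $\eta_i=+1$ ($i\in\{1,2\}$) if the endpoint on $s_i$ of the arrow to $s_3$ precedes that of the arrow to $s_4$, $\eta_j=+1$ ($j\in\{3,4\}$) if the endpoint on $s_j$ of the arrow from $s_1$ precedes that of the arrow from $s_2$, and $-1$ otherwise. $\mathrm{wBP}$: a $\mathrm{BP}$ move followed by an $\mathrm{SR}$ move on one of the four arrows involved. *)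

(* Defs.v *)
From Stdlib Require Import Relation_Operators.
From mathcomp Require Import all_boot all_order all_algebra.
Set Implicit Arguments.
Unset Strict Implicit.
Unset Printing Implicit Defensive.
Import GRing.Theory.
Local Open Scope ring_scope.

(** A Gauss diagram is encoded by the word of its endpoints, read along the
    oriented strand (for a circle, starting from an arbitrary base point).  An
    endpoint [(a, k, s)] records the label [a] of its arrow, whether it is the
    head ([k = true]) or the tail ([k = false]), and the sign of its arrow. *)

Definition endpoint : Type := (nat * bool * bool)%type.

Definition arrow_tail (a : nat) (s : bool) : endpoint := (a, false, s).
Definition arrow_head (a : nat) (s : bool) : endpoint := (a, true, s).

Definition other_end (x : endpoint) : endpoint := (x.1.1, ~~ x.1.2, x.2).

(** Signs are booleans, [true] being +1. *)
Definition pm (b : bool) : int := if b then 1 else -1.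

(** [uniq] disregards signs, so together the two conditions say that every label
    that occurs does so as exactly one tail and one head, of the same sign. *)
Definition is_gauss (w : seq endpoint) : bool :=
  uniq [seq x.1 | x <- w] && all (fun x => other_end x \in w) w.

Record gauss_diagram : Type :=
  GaussDiagram { word :> seq endpoint; wordP : is_gauss word }.

Definition no_arrow : gauss_diagram := @GaussDiagram [::] isT.

Inductive strand : Type := OneInterval | OneCircle.

Definition relabel (f : nat -> nat) (w : seq endpoint) : seq endpoint :=
  [seq (f x.1.1, x.1.2, x.2) | x <- w].

(** Orientation-preserving homeomorphism: the choice of the labels is
    irrelevant, and so is, on a circle, that of the base point. *)
Definition homeo (S : strand) (D D' : gauss_diagram) : Prop :=
  exists2 f : nat -> nat, injective f &
    match S with
    | OneInterval => word D' = relabel f D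
    | OneCircle => exists k : nat, word D' = rot k (relabel f D)
    end.

(** [replace ps w w']: [w] contains disjoint portions, in any order along the
    strand, whose contents are the first components of [ps], and [w'] is
    obtained by giving them the corresponding second components as contents.
    No portion wraps around the end of the word: on a circle, the base point can
    first be moved outside of the portions by [homeo]. *)
Inductive replace_in_order :
    seq (seq endpoint * seq endpoint) -> seq endpoint -> seq endpoint -> Prop :=
| ReplaceNone u : replace_in_order [::] u u
| ReplaceFirst u p q ps w w' : replace_in_order ps w w' ->
    replace_in_order ((p, q) :: ps) (u ++ p ++ w) (u ++ q ++ w').

Definition replace (ps : seq (seq endpoint * seq endpoint))
    (w w' : seq endpoint) : Prop :=
  exists2 qs, perm_eq ps qs & replace_in_order qs w w'.

(** A portion containing [x] and [y], where [x] precedes [y] iff [h]. *)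
Definition portion (h : bool) (x y : endpoint) : seq endpoint :=
  if h then [:: x; y] else [:: y; x].

Definition exchange (h : bool) (x y : endpoint) : seq endpoint * seq endpoint :=
  (portion h x y, portion (~~ h) x y).

(** Moves relate well-formed diagrams, so inserted labels are automatically fresh,
    and arrows with two endpoints of the same kind in the portions are distinct.
    Inverse moves are obtained by symmetry in [unknotting]. *)

Definition R1_move (D D' : gauss_diagram) : Prop :=
  exists a s h,
    replace [:: ([::], portion h (arrow_tail a s) (arrow_head a s))] D D'.

Definition R2_move (D D' : gauss_diagram) : Prop :=
  exists a b s h k,
    replace [:: ([::], portion h (arrow_tail a s) (arrow_tail b (~~ s)));
                ([::], portion k (arrow_head a s) (arrow_head b (~~ s)))] D D'.

(** In [R3_move] and [Delta_move], [hk] is the sign eta_k: it tells whether, on the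
    k-th portion, the endpoint shared with portion k-1 precedes the one shared with
    portion k+1 (indices mod 3). *)
Definition R3_move (D D' : gauss_diagram) : Prop :=
  exists a12 a23 a13 e12 e23 e13 h1 h2 h3,
    [/\ pm e12 * pm h1 * pm h2 = pm e23 * pm h2 * pm h3,
        pm e23 * pm h2 * pm h3 = - pm e13 * pm h1 * pm h3 &
        replace [:: exchange h1 (arrow_tail a13 e13) (arrow_tail a12 e12);
                    exchange h2 (arrow_head a12 e12) (arrow_tail a23 e23);
                    exchange h3 (arrow_head a23 e23) (arrow_head a13 e13)] D D'].

Definition OC_move (D D' : gauss_diagram) : Prop :=
  exists a b s t h,
    replace [:: exchange h (arrow_tail a s) (arrow_tail b t)] D D'.

Definition welded_Reidemeister (D D' : gauss_diagram) : Prop :=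
  [\/ R1_move D D', R2_move D D', R3_move D D' | OC_move D D'].

Definition F_move (D D' : gauss_diagram) : Prop :=
  exists a b s t h,
    a <> b /\ replace [:: exchange h (arrow_tail a s) (arrow_head b t)] D D'.

Definition VC_move (D D' : gauss_diagram) : Prop :=
  exists a s, replace [:: ([:: arrow_tail a s], [:: arrow_head a s]);
                          ([:: arrow_head a s], [:: arrow_tail a s])] D D'.

Definition SR_on (a : nat) (D D' : gauss_diagram) : Prop :=
  exists s, replace [:: ([:: arrow_tail a s], [:: arrow_tail a (~~ s)]);
                        ([:: arrow_head a s], [:: arrow_head a (~~ s)])] D D'.

Definition Delta_move (D D' : gauss_diagram) : Prop :=
  exists a12 a23 a31 e12 e23 e31 h1 h2 h3,
    [/\ pm e12 * pm h1 * pm h2 = pm e23 * pm h2 * pm h3,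
        pm e23 * pm h2 * pm h3 = pm e31 * pm h3 * pm h1 &
        replace [:: exchange h1 (arrow_head a31 e31) (arrow_tail a12 e12);
                    exchange h2 (arrow_head a12 e12) (arrow_tail a23 e23);
                    exchange h3 (arrow_head a23 e23) (arrow_tail a31 e31)] D D'].

(** The portions of the tails ([h1], [h2]) are ordered by target, those of the heads
    ([h3], [h4]) by source. *)
Definition BP_on (a13 a14 a23 a24 : nat) (D D' : gauss_diagram) : Prop :=
  exists e13 e14 e23 e24 h1 h2 h3 h4,
    [/\ pm e13 * pm h1 * pm h3 = pm e14 * pm h1 * pm h4,
        pm e14 * pm h1 * pm h4 = pm e23 * pm h2 * pm h3,
        pm e23 * pm h2 * pm h3 = pm e24 * pm h2 * pm h4 &
        replace
          [:: (portion h1 (arrow_tail a13 e13) (arrow_tail a14 e14),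
               portion h1 (arrow_head a13 (~~ e13)) (arrow_head a14 (~~ e14)));
              (portion h2 (arrow_tail a23 e23) (arrow_tail a24 e24),
               portion h2 (arrow_head a23 (~~ e23)) (arrow_head a24 (~~ e24)));
              (portion h3 (arrow_head a13 e13) (arrow_head a23 e23),
               portion h3 (arrow_tail a13 (~~ e13)) (arrow_tail a23 (~~ e23)));
              (portion h4 (arrow_head a14 e14) (arrow_head a24 e24),
               portion h4 (arrow_tail a14 (~~ e14)) (arrow_tail a24 (~~ e24)))] D D'].

Definition BP_move (D D' : gauss_diagram) : Prop :=
  exists a13 a14 a23 a24, BP_on a13 a14 a23 a24 D D'.

Definition wBP_move (D D' : gauss_diagram) : Prop :=
  exists a13 a14 a23 a24 a D1,
    [/\ BP_on a13 a14 a23 a24 D D1, a \in [:: a13; a14; a23; a24] &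
        SR_on a D1 D'].

Definition elementary (S : strand) (mu : gauss_diagram -> gauss_diagram -> Prop)
    (D D' : gauss_diagram) : Prop :=
  [\/ homeo S D D', welded_Reidemeister D D' | mu D D'].

Definition unknotting (S : strand)
    (mu : gauss_diagram -> gauss_diagram -> Prop) : Prop :=
  forall D : gauss_diagram,
    clos_refl_sym_trans gauss_diagram (elementary S mu) D no_arrow.

(* Main.v *)
Require Import Defs.
From mathcomp Require Import all_boot.
From Stdlib Require Import Relation_Operators.
From mathcomp Require Import all_algebra zify.

Set Implicit Arguments.
Unset Strict Implicit.
Unset Printing Implicit Defensive.

(** The tail and the head of an arrow [c] are written Tc and Hc below.

    Reduction to reversals.  Tails pass each other by OC.  If they can also pass
    the heads of the other arrows ([tails_pass_heads]), then every diagram is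
    trivial: carry a tail along the strand up to the head of its own arrow and
    delete the arrow by R1.  The move F is this very exchange.  Otherwise it is
    enough to know that every arrow can be reversed, possibly with a change of
    sign ([reversible]): to exchange a tail with a head, turn the head into a tail,
    apply OC, and turn it back.  VC is a reversal.  For Delta, BP and wBP the
    reversal obtained changes the sign, and it is built according to the word that
    the arrow encloses.  When that word consists of tails the arrow is a kink up to
    OC, whatever its direction and sign ([reversible_over_tails]).

    BP and wBP.  In a band pass, let the portions s1 and s4 be adjacent and the
    arrow from s1 to s4 be a kink between them.  Since R1 creates this kink before
    the move and deletes it afterwards, whatever its sign has become, three arrows
    that form a transitive triangle on three portions can be reversed
    simultaneously ([reverses_triangles]).  Such a triangle formed by an arrow [c]
    enclosing a single head, by the arrow of this head and by an auxiliary arrow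
    yields the reversal of [c] ([reversible_under_head]).  For longer words,
    a triangle splits the arrow at an intermediate point
    ([reversible_rcons]).

    Delta.  Let [x] be the last endpoint that an arrow [c] encloses.  It is pushed
    out of [c] by a triangle move on [c], on the arrow of [x] and on an arrow [n]
    of a pair of opposite parallel arrows [n], [n'] created by R2, with tails near
    the first endpoint of [c] and heads around the other end of [x].  This triangle
    is acyclic and the move is R3, except for one direction of [c] when [x] is a
    head: then it is cyclic and the move is Delta.  In all cases the result
    is the same word up to the direction of [c] ([rotate_over], [rotate_under]).  So the reversal of [c] over [v x] follows
    from its reversal over [Tn v].  Repeating this replaces everything enclosed by
    tails.  The only obstacle is that [v] itself gains endpoints when it contains
    the other end of [x]; a suitable weight shows that the process stops
    ([reversible_Delta_weight]). *)

(** * Labels and well-formed words *)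

Local Notation all_tails := (all (fun x : endpoint => ~~ x.1.2)).

Definition labels (w : seq endpoint) : seq nat := [seq x.1.1 | x <- w].

Lemma labels_cat u v : labels (u ++ v) = labels u ++ labels v.
Proof. exact: map_cat. Qed.

Lemma other_endK : involutive other_end.
Proof. by case=> [[a k] s]; rewrite /other_end /= negbK. Qed.

Lemma perm_labels u v : perm_eq u v -> labels u =i labels v.
Proof. by move=> /(perm_map (fun x : endpoint => x.1.1)); exact: perm_mem. Qed.

Lemma perm_is_gauss u v : perm_eq u v -> is_gauss u = is_gauss v.
Proof.
move=> uv; rewrite /is_gauss (perm_uniq (perm_map _ uv)) (perm_all _ uv).
by congr andb; apply: eq_all => x; rewrite (perm_mem uv).
Qed.

(** Together with invariance under permutation, this reduces the well-formedness of
    every word met below to the freshness of labels. *)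
Lemma is_gauss_arrow a s w :
  is_gauss [:: arrow_tail a s, arrow_head a s & w] =
  (a \notin labels w) && is_gauss w.
Proof.
rewrite /is_gauss /=.
have other_fresh k x : x \in w -> a \notin labels w ->
    (other_end x == (a, k, s)) = false.
  move=> xw; apply: contraNF => /eqP ex; apply/mapP; exists x => //.
  by rewrite -[x]other_endK ex.
have [aw /=|aw] := boolP (a \in labels w).
  suff: ((a, false) \in (a, true) :: [seq x.1 | x <- w]) ||
        ((a, true) \in [seq x.1 | x <- w]) by case/orP=> ->; rewrite ?andbF.
  case/mapP: aw => [[[b k] t] xw /= ->].
  have: (b, k) \in [seq x.1 | x <- w] by apply/mapP; exists (b, k, t).
  by case: k {xw} => h; rewrite ?inE h ?orbT.
have notin k : (a, k) \notin [seq x.1 | x <- w].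
  by apply: contra aw => /mapP[x xw ex]; apply/mapP; exists x => //; rewrite -ex.
rewrite !inE !(negPf (notin _)) /= !eqxx ?orbT /= !xpair_eqE eqxx /=.
by congr andb; apply: eq_in_all => x xw; rewrite !inE !other_fresh.
Qed.

Lemma is_gauss_uniq w : is_gauss w -> uniq w.
Proof. by case/andP=> /map_uniq. Qed.

Lemma other_end_in w x : is_gauss w -> x \in w -> other_end x \in w.
Proof. by case/andP=> _ /allP; apply. Qed.

Lemma other_end_neq x : other_end x != x.
Proof. by case: x => [[a []] s]; rewrite !xpair_eqE /= andbF. Qed.

Lemma fresh_labels (w : seq nat) :
  exists n n', [/\ n \notin w, n' \notin w & n != n'].
Proof.
have out k : (\max_(i <- w) i < k)%N -> k \notin w.
  by move=> lt_k; apply: contraL lt_k => kw; rewrite -leqNgt (leq_bigmax_seq _ kw).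
exists (\max_(i <- w) i).+1, (\max_(i <- w) i).+2; split; first exact: out.
  exact: out.
by rewrite neq_ltn ltnSn.
Qed.

(** * Words with holes *)

(** Several portions of a word are modified at once, in an order along the strand
    that may vary.  A word in which they are replaced by numbered holes treats all
    these orders uniformly. *)
Definition context : Type := seq (endpoint + nat).

Definition holes (t : context) : seq nat :=
  pmap (fun l => if l is inr i then Some i else None) t.

Definition plug (t : context) (ws : seq (seq endpoint)) : seq endpoint :=
  flatten [seq match l with inl x => [:: x] | inr i => nth [::] ws i end | l <- t].

Definition solid (w : seq endpoint) : context := map inl w.

Lemma plug_cat t1 t2 ws : plug (t1 ++ t2) ws = plug t1 ws ++ plug t2 ws.
Proof. by rewrite /plug map_cat flatten_cat. Qed.

Lemma plug_hole i t ws : plug (inr i :: t) ws = nth [::] ws i ++ plug t ws.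
Proof. by []. Qed.

Lemma plug_letter x t ws : plug (inl x :: t) ws = x :: plug t ws.
Proof. by []. Qed.

Lemma plug_solid w ws : plug (solid w) ws = w.
Proof. by elim: w => //= x w IH; rewrite /plug /= -/(plug _ ws) IH. Qed.

Lemma holes_cat t1 t2 : holes (t1 ++ t2) = holes t1 ++ holes t2.
Proof. exact: pmap_cat. Qed.

Lemma holes_hole i t : holes (inr i :: t) = i :: holes t.
Proof. by []. Qed.

Lemma holes_letter x t : holes (inl x :: t) = holes t.
Proof. by []. Qed.

Lemma holes_solid w : holes (solid w) = [::].
Proof. by elim: w. Qed.

Lemma replace_in_order_catl u ps w w' : replace_in_order ps w w' ->
  replace_in_order ps (u ++ w) (u ++ w').
Proof.
case=> [v|v p q qs v1 v2 h]; first exact: ReplaceNone.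
by rewrite !(catA u v); apply: ReplaceFirst.
Qed.

Lemma replace_in_order_cat ps qs w w' v v' :
  replace_in_order ps w w' -> replace_in_order qs v v' ->
  replace_in_order (ps ++ qs) (w ++ v) (w' ++ v').
Proof.
move=> hw hv; elim: hw => [u|u p q rs u1 u2 _ IH] /=.
  exact: replace_in_order_catl.
by rewrite -!catA; apply: ReplaceFirst; rewrite -?catA.
Qed.

Lemma replace_portion u p q v :
  replace_in_order [:: (p, q)] (u ++ p ++ v) (u ++ q ++ v).
Proof. exact/ReplaceFirst/ReplaceNone. Qed.

Lemma replace_all p q : replace_in_order [:: (p, q)] p q.
Proof. by have := replace_portion [::] p q [::]; rewrite /= !cats0. Qed.

Lemma replace_plug t pss ws ws' :
    perm_eq (holes t) (iota 0 (size pss)) ->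
    (forall i, i < size pss ->
       replace_in_order (nth [::] pss i) (nth [::] ws i) (nth [::] ws' i)) ->
  replace (flatten pss) (plug t ws) (plug t ws').
Proof.
move=> ht hps; exists (flatten [seq nth [::] pss i | i <- holes t]).
  rewrite -{1}[pss](mkseq_nth [::]) /mkseq.
  by apply: perm_flatten; apply: perm_map; rewrite perm_sym.
have {}hps i : i \in holes t ->
    replace_in_order (nth [::] pss i) (nth [::] ws i) (nth [::] ws' i).
  by rewrite (perm_mem ht) mem_iota => /hps.
elim: t {ht} hps => [|[x|i] t IH] hps; first exact: ReplaceNone.
  exact: (replace_in_order_catl [:: x]) (IH hps).
rewrite holes_hole /= !plug_hole; apply: replace_in_order_cat.
  by apply: hps; rewrite inE eqxx.
by apply: IH => j jt; apply: hps; rewrite inE jt orbT.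
Qed.

(** Forgetting the positions of the portions is enough to compare well-formedness
    before and after a move. *)
Lemma replace_rest ps w w' : replace ps w w' ->
  exists2 r, perm_eq w (flatten (unzip1 ps) ++ r)
           & perm_eq w' (flatten (unzip2 ps) ++ r).
Proof.
case=> qs pq h.
suff [r hw hw']: exists2 r, perm_eq w (flatten (unzip1 qs) ++ r)
    & perm_eq w' (flatten (unzip2 qs) ++ r).
  exists r; [move: hw | move: hw'] => /perm_trans; apply; rewrite perm_cat2r;
    by apply: perm_flatten; apply: perm_map; rewrite perm_sym.
elim: h => {pq} [u|u p q rs v v' _ [r hv hv']]; first by exists u.
by exists (u ++ r) => /=; rewrite -!catA perm_catCA perm_cat2l
  perm_sym perm_catCA perm_sym perm_cat2l.
Qed.

(** * Words up to moves *)

Section Equivalence.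

Variable mu : gauss_diagram -> gauss_diagram -> Prop.

(** Stated on words, without proofs that they are Gauss diagrams; the first
    condition is what makes this an equivalence relation on all words. *)
Definition equivalent (w w' : seq endpoint) : Prop :=
  is_gauss w = is_gauss w' /\
  forall (g : is_gauss w) (g' : is_gauss w'),
    clos_refl_sym_trans gauss_diagram (elementary OneInterval mu)
      (GaussDiagram g) (GaussDiagram g').

Local Notation "w <~> w'" := (equivalent w w') (at level 70).

Lemma eqv_refl w : w <~> w.
Proof.
by split=> // g g'; rewrite (bool_irrelevance g g'); apply: rst_refl.
Qed.

Lemma eqv_sym w w' : w <~> w' -> w' <~> w.
Proof. by case=> e h; split=> // g g'; apply/rst_sym/h. Qed.

Lemma eqv_trans w' w w'' : w <~> w' -> w' <~> w'' -> w <~> w''.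
Proof.
move=> [e h] [e' h']; split=> [|g g'']; first by rewrite e.
have g' : is_gauss w' by rewrite -e.
exact: rst_trans (h g g') (h' g' g'').
Qed.

Lemma eqv_gauss w w' : is_gauss w = is_gauss w' -> (is_gauss w -> w <~> w') ->
  w <~> w'.
Proof. by move=> e h; split=> // g; have [_] := h g; apply. Qed.

Lemma eqv_step (M : gauss_diagram -> gauss_diagram -> Prop) w w' :
    (forall D D', M D D' -> elementary OneInterval mu D D') ->
    is_gauss w = is_gauss w' ->
    (forall D D' : gauss_diagram, word D = w -> word D' = w' -> M D D') ->
  w <~> w'.
Proof. by move=> hM e h; split=> // g g'; apply/rst_step/hM/h. Qed.

Lemma elementary_R D D' : welded_Reidemeister D D' ->
  elementary OneInterval mu D D'.
Proof. by constructor 2. Qed.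

Lemma elementary_mu D D' : mu D D' -> elementary OneInterval mu D D'.
Proof. by constructor 3. Qed.

Lemma count_portion p h x y : count p (portion h x y) = p x + p y.
Proof. by case: h; rewrite /= addn0 // addnC. Qed.

Lemma eqv_R1 a s h w w' : a \notin labels w ->
    replace [:: ([::], portion h (arrow_tail a s) (arrow_head a s))] w w' ->
  w <~> w'.
Proof.
move=> aw rep.
apply: (eqv_step (M := R1_move)) => [D D' m|| D D' eD eD'].
- by apply: elementary_R; constructor 1.
- have [r /= wr] := replace_rest rep; rewrite cats0 => w'r.
  have {}w'r : perm_eq w' [:: arrow_tail a s, arrow_head a s & r].
    apply: perm_trans w'r _; case: (h) => //=.
    by rewrite -cat1s -(cat1s (arrow_tail a s)) perm_catCA.
  rewrite (perm_is_gauss w'r) (perm_is_gauss wr) is_gauss_arrow.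
  by rewrite -(perm_labels wr) aw.
- by exists a, s, h; rewrite eD eD'.
Qed.

Lemma eqv_kink h a s u v : a \notin labels (u ++ v) ->
  u ++ v <~> u ++ portion h (arrow_tail a s) (arrow_head a s) ++ v.
Proof.
move=> auv; apply: (eqv_R1 (s := s) (h := h) auv).
by eexists; [exact: perm_refl | exact: (replace_portion u [::] _ v)].
Qed.

Lemma eqv_R2 a b s h k w w' : a \notin labels w -> b \notin labels w -> a != b ->
    replace [:: ([::], portion h (arrow_tail a s) (arrow_tail b (~~ s)));
                ([::], portion k (arrow_head a s) (arrow_head b (~~ s)))] w w' ->
  w <~> w'.
Proof.
move=> aw bw ab rep.
apply: (eqv_step (M := R2_move)) => [D D' m|| D D' eD eD'].
- by apply: elementary_R; constructor 2.
- have [r /= wr] := replace_rest rep; rewrite cats0 => w'r.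
  have {}w'r : perm_eq w' [:: arrow_tail a s, arrow_head a s,
      arrow_tail b (~~ s), arrow_head b (~~ s) & r].
    apply: perm_trans w'r _; rewrite -!catA.
    by apply/permP => p; rewrite !count_cat !count_portion /=; lia.
  rewrite (perm_is_gauss w'r) (perm_is_gauss wr) !is_gauss_arrow /= !inE.
  by rewrite -!(perm_labels wr) (negPf ab) aw bw.
- by exists a, b, s, h, k; rewrite eD eD'.
Qed.

Lemma eqv_exchange (M : gauss_diagram -> gauss_diagram -> Prop) ps w w' :
    (forall D D', M D D' -> elementary OneInterval mu D D') ->
    all (fun p => perm_eq p.1 p.2) ps -> replace ps w w' ->
    (forall D D' : gauss_diagram, replace ps D D' -> M D D') ->
  w <~> w'.
Proof.
move=> hM hps rep h; apply: (eqv_step hM) => [|D D' eD eD']; last first.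
  by apply: h; rewrite eD eD'.
have [r hw hw'] := replace_rest rep.
rewrite (perm_is_gauss hw) (perm_is_gauss hw'); apply: perm_is_gauss.
rewrite perm_cat2r; elim: ps hps {rep h hw hw'} => //= p ps IH /andP[hp /IH].
exact: perm_cat.
Qed.

Lemma perm_exchange h x y : perm_eq (exchange h x y).1 (exchange h x y).2.
Proof. by case: h; rewrite /= (perm_catC [:: _] [:: _]). Qed.

Lemma eqv_OC a b s t u v :
  u ++ [:: arrow_tail a s, arrow_tail b t & v] <~>
  u ++ [:: arrow_tail b t, arrow_tail a s & v].
Proof.
apply: (eqv_exchange (M := OC_move)
          (ps := [:: exchange true (arrow_tail a s) (arrow_tail b t)])).
- by move=> D D' m; apply: elementary_R; constructor 4.
- by rewrite /= andbT; exact: (perm_exchange true).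
- by eexists; [exact: perm_refl | exact: (replace_portion u _ _ v)].
- by move=> D D' rep; exists a, b, s, t, true.
Qed.

(** The sign condition of R3 with the common factors eta_2 and eta_3 simplified,
    equality of booleans being the product of signs. *)
Lemma eqv_R3 a12 a23 a13 e12 e23 e13 h1 h2 h3 w w' :
    [&& (e12 == h1) == (e23 == h3) & (e23 == h2) != (e13 == h1)] ->
    replace [:: exchange h1 (arrow_tail a13 e13) (arrow_tail a12 e12);
                exchange h2 (arrow_head a12 e12) (arrow_tail a23 e23);
                exchange h3 (arrow_head a23 e23) (arrow_head a13 e13)] w w' ->
  w <~> w'.
Proof.
move=> he rep; apply: (eqv_exchange (M := R3_move) _ _ rep).
- by move=> D D' m; apply: elementary_R; constructor 3.
- by rewrite /= !perm_exchange.
- move=> D D' rep'; exists a12, a23, a13, e12, e23, e13, h1, h2, h3.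
  move: he {rep rep'} (rep') => he rep'; split=> //; clear rep';
  by move: he; case: e12; case: e23; case: e13; case: h1; case: h2; case: h3.
Qed.

(** * Unknotting from reversals *)

Lemma eqv_cancel_kink h a s u v : a \notin labels (u ++ v) ->
  u ++ portion h (arrow_tail a s) (arrow_head a s) ++ v <~> u ++ v.
Proof. by move=> auv; apply/eqv_sym/eqv_kink. Qed.

Lemma eqv_tail_past_tails a s u v r : all_tails v ->
  u ++ arrow_tail a s :: v ++ r <~> u ++ v ++ arrow_tail a s :: r.
Proof.
elim: v u => [|[[b k] t] v IH] u /=; first by move=> _; apply: eqv_refl.
case/andP; case: k => // _ vt; apply: eqv_trans (eqv_OC _ _ _ _ _ _) _.
by have := IH (rcons u (b, false, t)) vt; rewrite !cat_rcons.
Qed.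

Definition tails_pass_heads : Prop := forall a b s t u v, a != b ->
  u ++ [:: arrow_tail a s, arrow_head b t & v] <~>
  u ++ [:: arrow_head b t, arrow_tail a s & v].

Lemma eqv_tail_past a s u v r : tails_pass_heads -> a \notin labels v ->
  u ++ arrow_tail a s :: v ++ r <~> u ++ v ++ arrow_tail a s :: r.
Proof.
move=> pass; elim: v u => [|[[b k] t] v IH] u /=; first by move=> _; apply: eqv_refl.
rewrite inE negb_or => /andP[ab av].
have := IH (rcons u (b, k, t)) av; rewrite !cat_rcons; apply: eqv_trans.
by case: k; [apply: pass | apply: eqv_OC].
Qed.

(** By induction on the number of arrows, removing the arrow of the first
    endpoint. *)
Lemma trivial_of_tails_pass_heads w : tails_pass_heads -> is_gauss w ->
  w <~> [::].
Proof.
move=> pass; have [n] := ubnP (size w).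
elim: n w => // n IH [|[[a k] s] w] /=; first by move=> *; apply: eqv_refl.
rewrite ltnS => le_w g.
have ow : other_end (a, k, s) \in w.
  have := other_end_in g (mem_head _ _).
  by rewrite inE (negPf (other_end_neq _)).
case/splitPr: ow le_w g => v r le_w g.
have pg : perm_eq ((a, k, s) :: v ++ other_end (a, k, s) :: r)
    [:: arrow_tail a s, arrow_head a s & v ++ r].
  apply/permP => p; case: (k) => /=;
  by rewrite !count_cat /= /other_end /arrow_tail /arrow_head /=; lia.
rewrite (perm_is_gauss pg) is_gauss_arrow in g; case/andP: g => avr g.
have av : a \notin labels v by move: avr; rewrite labels_cat mem_cat negb_or => /andP[].
have le_vr : size (v ++ r) < n by move: le_w; rewrite !size_cat /= addnS => /ltnW.
apply: eqv_trans (IH _ le_vr g).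
case: k {le_w pg} => /=.
  apply: eqv_trans (eqv_sym (eqv_tail_past s [:: arrow_head a s] r pass av)) _.
  exact: (eqv_cancel_kink false s (u := [::]) avr).
apply: eqv_trans (eqv_tail_past s [::] (arrow_head a s :: r) pass av) _.
exact: (eqv_cancel_kink true s avr).
Qed.

(** Reversing the arrows of sign [e] that enclose [v], in all contexts; [f] tells
    whether the sign is changed. *)
Definition reversible (f e : bool) (v : seq endpoint) : Prop := forall c u r,
  u ++ arrow_tail c e :: v ++ arrow_head c e :: r <~>
  u ++ arrow_head c (f (+) e) :: v ++ arrow_tail c (f (+) e) :: r.

Lemma tails_pass_heads_of_reversible f :
  (forall e v, reversible f e v) -> tails_pass_heads.
Proof.
move=> rev a b s t u v ab.
apply: eqv_gauss => [|g].
  by apply: perm_is_gauss; rewrite perm_cat2l (perm_catCA [:: _] [:: _]).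
have : other_end (arrow_head b t) \in u ++ [:: arrow_tail a s, arrow_head b t & v].
  by apply: other_end_in => //; rewrite mem_cat !inE eqxx !orbT.
have -> : other_end (arrow_head b t) = arrow_tail b t by [].
rewrite mem_cat !inE !xpair_eqE eq_sym (negPf ab) /= !andbF /=.
case/orP=> /splitPr[u1 u2].
  (* The arrow [b] is reversed once enclosing [Ta] and once not. *)
  have := rev t (u2 ++ [:: arrow_tail a s]) b u1 v; rewrite -!catA /= => h.
  apply: eqv_trans h _.
  have := eqv_sym (rev t u2 b u1 (arrow_tail a s :: v)); apply: eqv_trans.
  have := eqv_OC a b s (f (+) t) (u1 ++ arrow_head b (f (+) t) :: u2) v.
  by rewrite -!catA.
have := rev (f (+) t) u1 b (u ++ [:: arrow_tail a s]) u2.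
rewrite addKb -!catA /= => /eqv_sym rev_in; apply: eqv_trans rev_in _.
apply: eqv_trans (eqv_OC _ _ _ _ _ _) _.
by have := rev (f (+) t) (arrow_tail a s :: u1) b u u2; rewrite addKb.
Qed.

End Equivalence.

(** * The moves F and VC *)

Local Notation "w <~> w'" := (equivalent _ w w') (at level 70).

Lemma tails_pass_heads_F : tails_pass_heads F_move.
Proof.
move=> a b s t u v ab.
apply: (eqv_exchange (M := F_move)
          (ps := [:: exchange true (arrow_tail a s) (arrow_head b t)])).
- by move=> D D'; apply: elementary_mu.
- by rewrite /= andbT; exact: (perm_exchange true).
- by eexists; [exact: perm_refl | exact: (replace_portion u _ _ v)].
- by move=> D D' rep; exists a, b, s, t, true; split=> //; apply/eqP.
Qed.

Lemma is_gauss_reverse c e e' u v r :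
  is_gauss (u ++ arrow_tail c e :: v ++ arrow_head c e :: r) =
  is_gauss (u ++ arrow_head c e' :: v ++ arrow_tail c e' :: r).
Proof.
have split_off x y : perm_eq (u ++ x :: v ++ y :: r) [:: x, y & u ++ v ++ r].
  by apply/permP => p; rewrite /= !count_cat /= !count_cat /=; lia.
rewrite (perm_is_gauss (split_off _ _)) is_gauss_arrow.
rewrite (perm_is_gauss (split_off _ _)).
by rewrite (perm_is_gauss (permEl (perm_catCA [:: _] [:: _] _))) is_gauss_arrow.
Qed.

Lemma reversible_VC e v : reversible VC_move false e v.
Proof.
move=> c u r; apply: (eqv_step (M := VC_move)).
- by move=> D D'; apply: elementary_mu.
- exact: is_gauss_reverse.
- move=> D D' eD eD'; exists c, e; rewrite eD eD'.
  eexists; first exact: perm_refl.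
  apply: (ReplaceFirst u [:: _] [:: _]).
  exact: (replace_portion v [:: _] [:: _] r).
Qed.

(** * Triangle reversals from band passes *)

Lemma replace_perm ps qs w w' : perm_eq ps qs -> replace ps w w' ->
  replace qs w w'.
Proof.
by move=> pq [rs prs h]; exists rs => //; apply: perm_trans prs; rewrite perm_sym.
Qed.

(** Three arrows between portions x, y, z, listed in this order: 13 from x to z,
    23 from y to z and 24 from y to x.  The indices are those of the band pass
    where x is the union of s1 and s4, and [m] is the place of the kink from s1 to
    s4. *)
Definition triangle (a13 a24 a23 : nat) (e13 e24 e23 h h2 h3 : bool) (m : seq endpoint) :=
  [:: if h then arrow_tail a13 e13 :: m ++ [:: arrow_head a24 e24]
      else arrow_head a24 e24 :: m ++ [:: arrow_tail a13 e13];
      portion h2 (arrow_tail a23 e23) (arrow_tail a24 e24);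
      portion h3 (arrow_head a13 e13) (arrow_head a23 e23)].

Definition reversed_triangle (a13 a24 a23 : nat) (e13 e24 e23 h h2 h3 : bool)
    (m : seq endpoint) :=
  [:: if h then arrow_head a13 (~~ e13) :: m ++ [:: arrow_tail a24 (~~ e24)]
      else arrow_tail a24 (~~ e24) :: m ++ [:: arrow_head a13 (~~ e13)];
      portion h2 (arrow_head a23 (~~ e23)) (arrow_head a24 (~~ e24));
      portion h3 (arrow_tail a13 (~~ e13)) (arrow_tail a23 (~~ e23))].

(** The sign condition of BP when eta_1 = eta_4 = [h]; the sign of the kink is
    then determined. *)
Definition compatible (e13 e24 e23 h h2 h3 : bool) : bool :=
  ((e13 == h) == (e23 == h2)) && ((e23 == h3) == (e24 == h)).

Definition reverses_triangles (mu : gauss_diagram -> gauss_diagram -> Prop) : Prop :=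
  forall t a13 a24 a23 e13 e24 e23 h h2 h3,
    perm_eq (holes t) (iota 0 3) -> compatible e13 e24 e23 h h2 h3 ->
    equivalent mu (plug t (triangle a13 a24 a23 e13 e24 e23 h h2 h3 [::]))
                  (plug t (reversed_triangle a13 a24 a23 e13 e24 e23 h h2 h3 [::])).

Definition band_portions a13 a14 a23 a24 e13 e14 e23 e24 h1 h2 h3 h4 :=
  [:: (portion h1 (arrow_tail a13 e13) (arrow_tail a14 e14),
       portion h1 (arrow_head a13 (~~ e13)) (arrow_head a14 (~~ e14)));
      (portion h2 (arrow_tail a23 e23) (arrow_tail a24 e24),
       portion h2 (arrow_head a23 (~~ e23)) (arrow_head a24 (~~ e24)));
      (portion h3 (arrow_head a13 e13) (arrow_head a23 e23),
       portion h3 (arrow_tail a13 (~~ e13)) (arrow_tail a23 (~~ e23)));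
      (portion h4 (arrow_head a14 e14) (arrow_head a24 e24),
       portion h4 (arrow_tail a14 (~~ e14)) (arrow_tail a24 (~~ e24)))].

Lemma is_gauss_bands a13 a14 a23 a24 e13 e14 e23 e24 h1 h2 h3 h4 w w' :
  replace (band_portions a13 a14 a23 a24 e13 e14 e23 e24 h1 h2 h3 h4) w w' ->
  is_gauss w = is_gauss w'.
Proof.
case/replace_rest=> r /perm_is_gauss-> /perm_is_gauss->.
pose arrows f13 f14 f23 f24 :=
  [:: arrow_tail a13 f13, arrow_head a13 f13, arrow_tail a14 f14, arrow_head a14 f14,
      arrow_tail a23 f23, arrow_head a23 f23, arrow_tail a24 f24, arrow_head a24 f24
    & r].
transitivity (is_gauss (arrows e13 e14 e23 e24)).
  apply: perm_is_gauss; apply/permP => p.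
  by rewrite /= cats0 -!catA !count_cat !count_portion /=; lia.
transitivity (is_gauss (arrows (~~ e13) (~~ e14) (~~ e23) (~~ e24))).
  by rewrite !is_gauss_arrow.
apply: perm_is_gauss; apply/permP => p.
by rewrite /= cats0 -!catA !count_cat !count_portion /=; lia.
Qed.

Definition kink h k e := portion h (arrow_tail k e) (arrow_head k e).

(** The kink spans the boundary between s1 and s4, which come in the order given
    by [h]; its reversal is read as a kink with its endpoints in the other order. *)
Lemma replace_bands t a13 a24 a23 k e13 e24 e23 e14 h h2 h3 :
    perm_eq (holes t) (iota 0 3) ->
  replace (band_portions a13 k a23 a24 e13 e14 e23 e24 h h2 h3 h)
    (plug t (triangle a13 a24 a23 e13 e24 e23 h h2 h3 (kink h k e14)))
    (plug t (reversed_triangle a13 a24 a23 e13 e24 e23 h h2 h3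
               (kink (~~ h) k (~~ e14)))).
Proof.
move=> ht; set ps := band_portions _ _ _ _ _ _ _ _ _ _ _ _.
pose p1 := nth ([::], [::]) ps 0; pose p2 := nth ([::], [::]) ps 1.
pose p3 := nth ([::], [::]) ps 2; pose p4 := nth ([::], [::]) ps 3.
have eps : ps = [:: p1; p2; p3; p4] by [].
pose pss := [:: (if h then [:: p1; p4] else [:: p4; p1]); [:: p2]; [:: p3]].
apply: (@replace_perm (flatten pss)).
  by rewrite eps /pss; apply/permP => p; case: (h) => /=; lia.
apply: replace_plug => // -[|[|[|//]]] _ /=; last 2 first.
- exact: replace_all.
- exact: replace_all.
rewrite /pss /= /p1 /p4 /ps /kink /=; case: (h) => /=.
  exact: (replace_in_order_cat (replace_all [:: _; _] [:: _; _])
                               (replace_all [:: _; _] [:: _; _])).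
exact: (replace_in_order_cat (replace_all [:: _; _] [:: _; _])
                             (replace_all [:: _; _] [:: _; _])).
Qed.

Lemma replace_kink_in_triangle t a13 a24 a23 k e13 e24 e23 e h h' h2 h3 :
    perm_eq (holes t) (iota 0 3) ->
  replace [:: ([::], kink h' k e)]
    (plug t (triangle a13 a24 a23 e13 e24 e23 h h2 h3 [::]))
    (plug t (triangle a13 a24 a23 e13 e24 e23 h h2 h3 (kink h' k e))).
Proof.
move=> ht; apply: (@replace_plug t [:: [:: ([::], kink h' k e)]; [::]; [::]]) => //.
case=> [|[|[|//]]] _ /=; try exact: ReplaceNone.
case: h; last exact: (replace_portion [:: _] [::] _ [:: _]).
exact: (replace_portion [:: _] [::] _ [:: _]).
Qed.

Lemma replace_kink_in_reversed_triangle t a13 a24 a23 k e13 e24 e23 e h h' h2 h3 :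
    perm_eq (holes t) (iota 0 3) ->
  replace [:: ([::], kink h' k e)]
    (plug t (reversed_triangle a13 a24 a23 e13 e24 e23 h h2 h3 [::]))
    (plug t (reversed_triangle a13 a24 a23 e13 e24 e23 h h2 h3 (kink h' k e))).
Proof.
move=> ht; apply: (@replace_plug t [:: [:: ([::], kink h' k e)]; [::]; [::]]) => //.
case=> [|[|[|//]]] _ /=; try exact: ReplaceNone.
case: h; last exact: (replace_portion [:: _] [::] _ [:: _]).
exact: (replace_portion [:: _] [::] _ [:: _]).
Qed.

(** The kink is deleted after the band pass, so its final sign does not matter:
    [b] is true for BP and false for wBP, where SR is applied to the kink. *)
Lemma reverses_triangles_of_bands mu (b : bool) :
    (forall t a13 a24 a23 k e13 e24 e23 e14 h h2 h3,
       let w := plug t (triangle a13 a24 a23 e13 e24 e23 h h2 h3 (kink h k e14)) in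
       let w' := plug t (reversed_triangle a13 a24 a23 e13 e24 e23 h h2 h3
                           (kink (~~ h) k (b (+) e14))) in
       perm_eq (holes t) (iota 0 3) -> compatible e13 e24 e23 h h2 h3 ->
       e14 = ((e13 == h) == h3) ->
       equivalent mu w w') ->
  reverses_triangles mu.
Proof.
move=> bands t a13 a24 a23 e13 e24 e23 h h2 h3 ht he.
pose e14 := (e13 == h) == h3.
set w := plug _ _; set w' := plug _ _.
have [k [_ [kww' _ _]]] := fresh_labels (labels (w ++ w')).
move: kww'; rewrite labels_cat mem_cat negb_or => /andP[kw kw'].
have kink_w := replace_kink_in_triangle a13 a24 a23 k e13 e24 e23 e14 h h h2 h3 ht.
apply: eqv_trans (eqv_R1 mu kw kink_w) _.
apply: eqv_trans (bands _ _ _ _ k _ _ _ e14 _ _ _ ht he _) _ => //.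
exact: eqv_sym (eqv_R1 mu kw' (replace_kink_in_reversed_triangle _ _ _ _ _ _ _ _ _ _ _ _ ht)).
Qed.

Lemma BP_on_bands a13 a14 a23 a24 e13 e14 e23 e24 h h2 h3 (D D' : gauss_diagram) :
    compatible e13 e24 e23 h h2 h3 -> e14 = ((e13 == h) == h3) ->
    replace (band_portions a13 a14 a23 a24 e13 e14 e23 e24 h h2 h3 h) D D' ->
  BP_on a13 a14 a23 a24 D D'.
Proof.
move=> he e14E rep; exists e13, e14, e23, e24, h, h2, h3, h.
suff : [/\ (pm e13 * pm h * pm h3 = pm e14 * pm h * pm h)%R,
            (pm e14 * pm h * pm h = pm e23 * pm h2 * pm h3)%R &
            (pm e23 * pm h2 * pm h3 = pm e24 * pm h2 * pm h)%R] by case; split.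
move: he; rewrite {}e14E {rep}.
by case: e13; case: e23; case: e24; case: h; case: h2; case: h3.
Qed.

Lemma reverses_triangles_BP : reverses_triangles BP_move.
Proof.
apply: (reverses_triangles_of_bands (b := true)) => t a13 a24 a23 k e13 e24 e23 e14 h h2 h3.
move=> w w' ht he e14E; have rep := replace_bands a13 a24 a23 k e13 e24 e23 e14 h h2 h3 ht.
apply: (eqv_step (M := BP_move)) => [D D'||D D' eD eD']; first exact: elementary_mu.
  exact: is_gauss_bands rep.
exists a13, k, a23, a24; apply: BP_on_bands he e14E _.
by rewrite eD eD'.
Qed.

Lemma reverses_triangles_wBP : reverses_triangles wBP_move.
Proof.
apply: (reverses_triangles_of_bands (b := false)) => t a13 a24 a23 k e13 e24 e23 e14 h h2 h3.
move=> w w' ht he e14E; have rep := replace_bands a13 a24 a23 k e13 e24 e23 e14 h h2 h3 ht.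
set w1 := plug _ (reversed_triangle _ _ _ _ _ _ _ _ _ _) in rep.
pose ps := [:: ([:: arrow_tail k (~~ e14)], [:: arrow_tail k (~~ ~~ e14)]);
               ([:: arrow_head k (~~ e14)], [:: arrow_head k (~~ ~~ e14)])].
have sr : replace ps w1 w'.
  pose p := [:: (if h then rev ps else ps); [::]; [::]].
  apply: (@replace_perm (flatten p)).
    by rewrite /p /=; apply/permP => q; case: (h) => /=; lia.
  rewrite /w1 /w' -[b in false (+) b]negbK addFb; apply: replace_plug => //.
  case=> [|[|[|//]]] _ /=; try exact: ReplaceNone.
  rewrite /p /ps /kink; case: (h) => /=.
    apply: (ReplaceFirst [:: _] [:: _] [:: _]).
    exact: (replace_portion [::] [:: _] [:: _] [:: _]).
  apply: (ReplaceFirst [:: _] [:: _] [:: _]).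
  exact: (replace_portion [::] [:: _] [:: _] [:: _]).
have w1w' : is_gauss w1 = is_gauss w'.
  have [r /perm_is_gauss-> /perm_is_gauss->] := replace_rest sr.
  by rewrite !is_gauss_arrow.
have ww1 := is_gauss_bands rep.
apply: (eqv_gauss) => [|g]; first by rewrite ww1.
have g1 : is_gauss w1 by rewrite -ww1.
apply: (eqv_step (M := wBP_move)) => [D D'||D D' eD eD']; first exact: elementary_mu.
  by rewrite ww1.
exists a13, k, a23, a24, k, (GaussDiagram g1); split.
- by apply: BP_on_bands he e14E _; rewrite eD.
- by rewrite !inE eqxx !orbT.
- by exists (~~ e14); rewrite eD'.
Qed.

(** * Substituting around one endpoint *)

Definition subst (o : endpoint) (z w : seq endpoint) : seq endpoint :=
  flatten [seq if x == o then z else [:: x] | x <- w].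

(** The context whose pluggings are substitutions of [o]: it reaches the other end
    of an enclosed arrow wherever it lies. *)
Definition punch (o : endpoint) (z : context) (w : seq endpoint) : context :=
  flatten [seq if x == o then z else [:: inl x] | x <- w].

Lemma subst_cat o z u v : subst o z (u ++ v) = subst o z u ++ subst o z v.
Proof. by rewrite /subst map_cat flatten_cat. Qed.

Lemma subst_id o w : subst o [:: o] w = w.
Proof. by elim: w => //= x w {2}<-; rewrite /subst /=; case: eqP => [->|]. Qed.

Lemma subst_notin o z w : o \notin w -> subst o z w = w.
Proof.
elim: w => //= x w IH; rewrite inE negb_or eq_sym => /andP[xo /IH e].
by rewrite /subst /= (negPf xo) /= -/(subst _ _ _) e.
Qed.

Lemma plug_punch o z w ws : plug (punch o z w) ws = subst o (plug z ws) w.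
Proof.
elim: w => // x w IH; rewrite /punch /subst /= plug_cat -/(punch o z w) IH.
by case: eqP.
Qed.

Lemma holes_punch o z w :
  holes (punch o z w) = flatten (nseq (count_mem o w) (holes z)).
Proof.
elim: w => // x w IH; rewrite /punch /= holes_cat -/(punch o z w) IH.
by case: eqP.
Qed.

Definition plugE := (plug_cat, plug_punch, plug_solid, plug_hole, plug_letter).
Definition holesE :=
  (holes_cat, holes_punch, holes_solid, holes_hole, holes_letter).

Lemma gauss_other_label c e x u v r :
    is_gauss (u ++ arrow_tail c e :: v ++ arrow_head c e :: r) ->
  x \in u ++ v ++ r -> x.1.1 != c.
Proof.
move=> g xin; have pw : perm_eq (u ++ arrow_tail c e :: v ++ arrow_head c e :: r)
    [:: arrow_tail c e, arrow_head c e & u ++ v ++ r].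
  by apply/permP => p; rewrite /= !count_cat /= !count_cat /=; lia.
rewrite (perm_is_gauss pw) is_gauss_arrow in g; case/andP: g => + _.
by apply: contraNneq => <-; apply/mapP; exists x.
Qed.

Lemma count_other_end c e x u v r :
    is_gauss (u ++ arrow_tail c e :: v ++ arrow_head c e :: r) ->
    x \in u ++ v ++ r ->
  count_mem (other_end x) u + count_mem (other_end x) v
    + count_mem (other_end x) r = 1.
Proof.
move=> g xin; have xc := gauss_other_label g xin.
have xW : x \in u ++ arrow_tail c e :: v ++ arrow_head c e :: r.
  by move: xin; rewrite !(mem_cat, inE) => /or3P[] ->; rewrite ?orbT.
have := count_uniq_mem (other_end x) (is_gauss_uniq g).
rewrite (other_end_in g xW) !count_cat /= !count_cat /=.
have other k : (c, k, e) == other_end x = false.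
  by apply/negbTE; apply: contra xc => /eqP ex; rewrite -[x.1.1]/((other_end x).1.1) -ex.
rewrite !other; lia.
Qed.

Section Insertion.

Variable mu : gauss_diagram -> gauss_diagram -> Prop.
Local Notation "w <~> w'" := (equivalent mu w w') (at level 70).

Lemma eqv_R2_plug h k a b s t : perm_eq (holes t) (iota 0 2) ->
    a \notin labels (plug t [::]) -> b \notin labels (plug t [::]) -> a != b ->
  plug t [::] <~>
  plug t [:: portion h (arrow_tail a s) (arrow_tail b (~~ s));
             portion k (arrow_head a s) (arrow_head b (~~ s))].
Proof.
move=> ht aw bw ab; apply: (eqv_R2 mu (s := s) (h := h) (k := k) aw bw ab).
apply: (@replace_plug t [:: [:: ([::], _)]; [:: ([::], _)]]) => //.
by case=> [|[|//]] _ /=; apply: replace_all.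
Qed.

Lemma eqv_drop_kink h c e u v :
    is_gauss (u ++ portion h (arrow_tail c e) (arrow_head c e) ++ v) ->
  u ++ portion h (arrow_tail c e) (arrow_head c e) ++ v <~> u ++ v.
Proof.
move=> g; apply: eqv_cancel_kink.
have pw : perm_eq (u ++ portion h (arrow_tail c e) (arrow_head c e) ++ v)
    [:: arrow_tail c e, arrow_head c e & u ++ v].
  by apply/permP => p; case: (h); rewrite !count_cat /= count_cat; lia.
by rewrite (perm_is_gauss pw) is_gauss_arrow in g; case/andP: g.
Qed.

Lemma eqv_drop_over_tails c e u k r :
    all_tails k ->
    is_gauss (u ++ arrow_tail c e :: k ++ arrow_head c e :: r) ->
  u ++ arrow_tail c e :: k ++ arrow_head c e :: r <~> u ++ k ++ r.
Proof.
move=> kt g; have h := eqv_tail_past_tails mu c e u (arrow_head c e :: r) kt.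
apply: eqv_trans (h) _; rewrite !catA.
by apply: (eqv_drop_kink (h := true)); rewrite -catA -(proj1 h).
Qed.

Lemma eqv_drop_under_tails c e u k r :
    all_tails k ->
    is_gauss (u ++ arrow_head c e :: k ++ arrow_tail c e :: r) ->
  u ++ arrow_head c e :: k ++ arrow_tail c e :: r <~> u ++ k ++ r.
Proof.
move=> kt g.
have := eqv_sym (eqv_tail_past_tails mu c e (u ++ [:: arrow_head c e]) r kt).
rewrite -!catA /= => h; apply: eqv_trans (h) _.
by apply: (eqv_drop_kink (h := false)); rewrite -(proj1 h).
Qed.

(** Over tails both directions of the arrow are kinks, hence both are equivalent
    to having no arrow at all. *)
Lemma reversible_over_tails e k : all_tails k ->
  reversible mu true e k.
Proof.
move=> kt c u r; apply: eqv_gauss; first exact: is_gauss_reverse.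
move=> g; apply: eqv_trans (eqv_drop_over_tails kt g) _.
by apply/eqv_sym/eqv_drop_under_tails; rewrite -?(is_gauss_reverse c e).
Qed.

End Insertion.

(** * Reversals from triangle reversals *)

Section Triangles.

Variable mu : gauss_diagram -> gauss_diagram -> Prop.
Local Notation "w <~> w'" := (equivalent mu w w') (at level 70).

Hypothesis tri : reverses_triangles mu.

(** Let [c] enclose the head of [m].  Create by R2 two arrows [d], [d2] from a point
    next to Tm to a point next to [c], with [d] of the same sign as [m].  The arrows
    [c], [m], [d] form a compatible triangle, for one direction of [c] as for
    the other, the order of Tm and Td being imposed by the sign of [c].  After its
    reversal [c] encloses only a tail and can be deleted, and in both cases the
    word that remains is the same. *)
Lemma reversible_under_head e m s : reversible mu true e [:: arrow_head m s].
Proof.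
move=> c u r; apply: eqv_gauss => [|g]; first exact: is_gauss_reverse.
set o := arrow_tail m s.
have cnt : count_mem o u + count_mem o r = 1.
  have Hm : arrow_head m s \in u ++ [:: arrow_head m s] ++ r.
    by rewrite !(mem_cat, inE) eqxx orbT.
  have := count_other_end g Hm; rewrite -[other_end _]/o /= addn0.
  by rewrite [_ == o]eq_sym (negPf (other_end_neq (arrow_head m s))) addn0.
pose A := [:: arrow_tail c e; arrow_head m s; arrow_head c e].
pose B := [:: arrow_head c (~~ e); arrow_head m s; arrow_tail c (~~ e)].
have [d [d2 []]] := fresh_labels (labels ((u ++ A ++ r) ++ (u ++ B ++ r))).
rewrite !(labels_cat (u ++ A ++ r)) !mem_cat !negb_or => /andP[dA dB] /andP[d2A d2B] dd2.
pose h2 := e == s.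
pose z0 : context := if h2 then [:: inr 0; inl o] else [:: inl o; inr 0].
pose z1 : context := if h2 then [:: inl (arrow_tail d2 (~~ s)); inr 1]
                     else [:: inr 1; inl (arrow_tail d2 (~~ s))].
pose za := if h2 then [:: arrow_tail d2 (~~ s); arrow_tail d s; o]
           else [:: o; arrow_tail d s; arrow_tail d2 (~~ s)].
pose zb := if h2 then [:: arrow_tail d2 (~~ s); arrow_head d (~~ s); arrow_head m (~~ s)]
           else [:: arrow_head m (~~ s); arrow_head d (~~ s); arrow_tail d2 (~~ s)].
pose heads := [:: arrow_head d s; arrow_head d2 (~~ s)].
have count1 n (t : context) : holes t = [:: n] ->
    holes (punch o t u) = [:: n] /\ holes (punch o t r) = [::] \/
    holes (punch o t u) = [::] /\ holes (punch o t r) = [:: n].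
  rewrite !holes_punch => ->.
  by case: (count_mem o u) cnt => [|[|i]] //=; case: (count_mem o r) => [|[|j]] // _;
    [right | left].
have hz0 : holes z0 = [:: 0] by rewrite /z0; case: (h2).
have hz1 : holes z1 = [:: 1] by rewrite /z1; case: (h2).
have insert X : d \notin labels (u ++ X ++ r) -> d2 \notin labels (u ++ X ++ r) ->
    u ++ X ++ r <~> subst o za u ++ X ++ heads ++ subst o za r.
  move=> dX d2X; pose t := punch o z0 u ++ solid X ++ [:: inr 1] ++ punch o z0 r.
  have := @eqv_R2_plug mu (~~ h2) true d d2 s t.
  have -> : plug t [::] = u ++ X ++ r.
    by rewrite /t !plugE /z0; case: (h2); rewrite /= !subst_id.
  have -> : perm_eq (holes t) (iota 0 2).
    by rewrite /t !holes_cat holes_solid; case: (count1 _ _ hz0) => -[-> ->].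
  rewrite /t !plugE /za /z0 dX d2X dd2; case: (h2) => /=; exact.
pose t1 i j := punch o z1 u ++ [:: inr i; inr j; inl (arrow_head d2 (~~ s))] ++ punch o z1 r.
have ht1 i j : perm_eq [:: 1; i; j] (iota 0 3) -> perm_eq (holes (t1 i j)) (iota 0 3).
  move=> ij; rewrite /t1 !holes_cat; case: (count1 _ _ hz1) => -[-> ->] //.
  by apply: perm_trans ij; rewrite (permEl (perm_catC [:: i; j] [:: 1])).
(* What remains of either word once [c] is deleted. *)
pose common := subst o zb u ++
  [:: arrow_tail m (~~ s); arrow_tail d (~~ s); arrow_head d2 (~~ s)] ++ subst o zb r.
have plug_za k2 : (k2 = h2 -> plug z1 (triangle c m d e s s true k2 true [::]) = za) /\
    (k2 = ~~ h2 -> plug z1 (triangle c d m (~~ e) s s true k2 true [::]) = za).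
  by split=> ->; rewrite /z1 /za; case: (h2).
have plug_zb k2 : (k2 = h2 -> plug z1 (reversed_triangle c m d e s s true k2 true [::]) = zb) /\
    (k2 = ~~ h2 -> plug z1 (reversed_triangle c d m (~~ e) s s true k2 true [::]) = zb).
  by split=> ->; rewrite /z1 /zb; case: (h2).
have kink_over : u ++ A ++ r <~> common.
  have ins := insert A dA d2A.
  have compA : compatible e s s true h2 true.
    by rewrite /compatible /h2; case: (e); case: (s).
  have := tri c m d (ht1 0 2 isT) compA.
  rewrite /t1 !plugE (proj1 (plug_za h2)) // (proj1 (plug_zb h2)) //= => rev.
  apply: eqv_trans (ins) _; apply: eqv_trans (rev) _.
  apply: (@eqv_drop_under_tails mu c (~~ e) (subst o zb u) [:: arrow_tail m (~~ s)]) => //.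
  by rewrite -(proj1 rev) -(proj1 ins).
have kink_under : u ++ B ++ r <~> common.
  have ins := insert B dB d2B.
  have compB : compatible (~~ e) s s true (~~ h2) true.
    by rewrite /compatible /h2; case: (e); case: (s).
  have := tri c d m (ht1 2 0 isT) compB.
  rewrite /t1 !plugE (proj2 (plug_za _)) // (proj2 (plug_zb _)) //= !negbK => rev.
  apply: eqv_trans (ins) _; apply: eqv_trans (rev) _.
  apply: (@eqv_drop_over_tails mu c e (subst o zb u) [:: arrow_tail m (~~ s)]) => //.
  rewrite -(proj1 rev) -(proj1 ins).
  by move: g; rewrite (is_gauss_reverse c e (~~ e)).
exact: eqv_trans kink_over (eqv_sym kink_under).
Qed.

(** Let the arrow [c] enclose [v x].  Create a pair [f], [f2] enclosing [v] and a
    pair [d], [d2] enclosing [x].  The arrows [c], [f], [d] form a triangle, and its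
    reversal reverses [c].  The arrows [f2] and [d2], which enclose exactly [v] and
    [x], are then reversed by hypothesis and cancel against [f] and [d].  The words
    W0, W1, W2, W3 lead from the first word to this situation, and W6, W7, W5 from
    the second one. *)
Lemma reversible_rcons e v x : (forall e, reversible mu true e v) ->
    (forall e, reversible mu true e [:: x]) ->
  reversible mu true e (rcons v x).
Proof.
move=> rev_v rev_x c u r; rewrite -cats1 -?catA /=.
set W0 := u ++ _; set W6 := u ++ arrow_head c (~~ e) :: _.
have [f [f2 []]] := fresh_labels (labels (W0 ++ W6)).
rewrite labels_cat !mem_cat !negb_or => /andP[fW0 fW6] /andP[f2W0 f2W6] ff2.
pose W1 := u ++ [:: arrow_tail c e, arrow_head f e, arrow_head f2 (~~ e) & v ++
  [:: arrow_tail f2 (~~ e), arrow_tail f e, x, arrow_head c e & r]].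
pose W7 := u ++ [:: arrow_head c (~~ e), arrow_tail f (~~ e), arrow_tail f2 e & v ++
  [:: arrow_head f2 e, arrow_head f (~~ e), x, arrow_tail c (~~ e) & r]].
have [d [d2 []]] := fresh_labels (labels (W1 ++ W7)).
rewrite labels_cat !mem_cat !negb_or => /andP[dW1 dW7] /andP[d2W1 d2W7] dd2.
have W01 : W0 <~> W1.
  pose t := solid (u ++ [:: arrow_tail c e]) ++ inr 1 :: solid v ++
    inr 0 :: solid [:: x, arrow_head c e & r].
  have ht : perm_eq (holes t) (iota 0 2) by rewrite /t !holesE.
  have := @eqv_R2_plug mu false true f f2 e t ht.
  by rewrite /t !plugE -?catA; apply.
have W67 : W6 <~> W7.
  pose t := solid (u ++ [:: arrow_head c (~~ e)]) ++ inr 0 :: solid v ++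
    inr 1 :: solid [:: x, arrow_tail c (~~ e) & r].
  have ht : perm_eq (holes t) (iota 0 2) by rewrite /t !holesE.
  have := @eqv_R2_plug mu true false f f2 (~~ e) t ht.
  by rewrite /t !plugE -?catA negbK; apply.
pose W2 := u ++ [:: arrow_tail c e, arrow_head f e, arrow_head f2 (~~ e) & v ++
  [:: arrow_tail f2 (~~ e), arrow_tail f e, arrow_tail d (~~ e), arrow_tail d2 e,
      x, arrow_head d2 e, arrow_head d (~~ e), arrow_head c e & r]].
have W12 : W1 <~> W2.
  pose t := solid (u ++ [:: arrow_tail c e, arrow_head f e, arrow_head f2 (~~ e) & v ++
    [:: arrow_tail f2 (~~ e); arrow_tail f e]]) ++
    [:: inr 0, inl x, inr 1 & solid (arrow_head c e :: r)].
  have ht : perm_eq (holes t) (iota 0 2) by rewrite /t !holesE.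
  have := @eqv_R2_plug mu true false d d2 (~~ e) t ht.
  by rewrite /t !plugE -?catA /= -?catA /= negbK; apply.
pose W5 := u ++ [:: arrow_head c (~~ e), arrow_tail f (~~ e), arrow_tail f2 e & v ++
  [:: arrow_head f2 e, arrow_head f (~~ e), arrow_head d e, arrow_head d2 (~~ e),
      x, arrow_tail d2 (~~ e), arrow_tail d e, arrow_tail c (~~ e) & r]].
have W75 : W7 <~> W5.
  pose t := solid (u ++ [:: arrow_head c (~~ e), arrow_tail f (~~ e), arrow_tail f2 e &
    v ++ [:: arrow_head f2 e; arrow_head f (~~ e)]]) ++
    [:: inr 1, inl x, inr 0 & solid (arrow_tail c (~~ e) :: r)].
  have ht : perm_eq (holes t) (iota 0 2) by rewrite /t !holesE.
  have := @eqv_R2_plug mu false true d d2 e t ht.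
  by rewrite /t !plugE -?catA /= -?catA /=; apply.
pose W3 := u ++ [:: arrow_head c (~~ e), arrow_tail f (~~ e), arrow_head f2 (~~ e) & v ++
  [:: arrow_tail f2 (~~ e), arrow_head f (~~ e), arrow_head d e, arrow_tail d2 e,
      x, arrow_head d2 e, arrow_tail d e, arrow_tail c (~~ e) & r]].
have W23 : W2 <~> W3.
  pose t := solid u ++ inr 0 :: solid (arrow_head f2 (~~ e) :: v) ++
    [:: inl (arrow_tail f2 (~~ e)), inr 1, inl (arrow_tail d2 e), inl x,
        inl (arrow_head d2 e), inr 2 & solid r].
  have ht : perm_eq (holes t) (iota 0 3) by rewrite /t !holesE.
  have comp : compatible e e (~~ e) true false false by case: (e).
  by have := tri c f d ht comp; rewrite /t !plugE /= negbK.
have W34 : W3 <~> u ++ [:: arrow_head c (~~ e), arrow_tail f (~~ e), arrow_tail f2 e & v ++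
  [:: arrow_head f2 e, arrow_head f (~~ e), arrow_head d e, arrow_tail d2 e,
      x, arrow_head d2 e, arrow_tail d e, arrow_tail c (~~ e) & r]].
  have := rev_v e f2 (u ++ [:: arrow_head c (~~ e); arrow_tail f (~~ e)])
    [:: arrow_head f (~~ e), arrow_head d e, arrow_tail d2 e,
      x, arrow_head d2 e, arrow_tail d e, arrow_tail c (~~ e) & r].
  by rewrite -!catA => /eqv_sym.
have W45 := rev_x e d2 (u ++ [:: arrow_head c (~~ e), arrow_tail f (~~ e), arrow_tail f2 e &
  v ++ [:: arrow_head f2 e; arrow_head f (~~ e); arrow_head d e]])
  [:: arrow_tail d e, arrow_tail c (~~ e) & r].
rewrite -?catA /= -?catA /= in W45.
apply: eqv_trans W01 _; apply: eqv_trans W12 _; apply: eqv_trans W23 _.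
apply: eqv_trans W34 _; apply: eqv_trans W45 _.
exact: eqv_trans (eqv_sym W75) (eqv_sym W67).
Qed.

Lemma reversible_of_triangles e v : reversible mu true e v.
Proof.
elim/last_ind: v e => [|v x IH] e; first exact: reversible_over_tails.
apply: reversible_rcons => // {}e; case: x => [[m []] s].
  exact: reversible_under_head.
exact: reversible_over_tails.
Qed.

End Triangles.

(** * Pushing an endpoint out of an arrow by R3 and Delta *)

(** The sign condition of Delta with the common factors simplified as in
    [eqv_R3]. *)
Lemma eqv_Delta a12 a23 a31 e12 e23 e31 h1 h2 h3 w w' :
    [&& (e12 == h1) == (e23 == h3) & (e23 == h2) == (e31 == h1)] ->
    replace [:: exchange h1 (arrow_head a31 e31) (arrow_tail a12 e12);
                exchange h2 (arrow_head a12 e12) (arrow_tail a23 e23);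
                exchange h3 (arrow_head a23 e23) (arrow_tail a31 e31)] w w' ->
  equivalent Delta_move w w'.
Proof.
move=> he rep; apply: (eqv_exchange (M := Delta_move) _ _ rep).
- by move=> D D'; apply: elementary_mu.
- by rewrite /= !perm_exchange.
- move=> D D' rep'; exists a12, a23, a31, e12, e23, e31, h1, h2, h3.
  split=> //; clear - he; move: he;
  by case: e12; case: e23; case: e31; case: h1; case: h2; case: h3.
Qed.

Lemma perm_swap12 (T : eqType) (a b c : T) : perm_eq [:: a; b; c] [:: b; a; c].
Proof. by rewrite (permEl (perm_catCA [:: a] [:: b] _)). Qed.

Lemma perm_swap23 (T : eqType) (a b c : T) : perm_eq [:: a; b; c] [:: a; c; b].
Proof. by rewrite perm_cons (permEl (perm_catC [:: b] _)). Qed.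

Lemma exchangeC h x y : exchange h x y = exchange (~~ h) y x.
Proof. by case: h. Qed.

Lemma replace_plug3 t p0 p1 p2 : perm_eq (holes t) (iota 0 3) ->
  replace [:: p0; p1; p2] (plug t [:: p0.1; p1.1; p2.1])
                          (plug t [:: p0.2; p1.2; p2.2]).
Proof.
move=> ht; apply: (@replace_plug t [:: [:: p0]; [:: p1]; [:: p2]]) => //.
by case: p0 p1 p2 => [a a'] [b b'] [c c'] [|[|[|//]]] _ /=; apply: replace_all.
Qed.

(** The sign that the arrow [n] must have for the triangle moves that push [x] out
    of an arrow: that of [x] if [x] is a tail, the opposite one if it is a head. *)
Definition conj_sign (x : endpoint) : bool := x.2 (+) x.1.2.

(** What replaces the other end of [x]: the pair [n], [n'] now has one head on each
    side of it.  The head on the left has the sign [e] of the arrow that [x] has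
    left. *)
Definition flanked (e : bool) (x : endpoint) (n n' : nat) : seq endpoint :=
  let hn := arrow_head n (conj_sign x) in
  let hn' := arrow_head n' (~~ conj_sign x) in
  if e == conj_sign x then [:: hn; other_end x; hn'] else [:: hn'; other_end x; hn].

Local Notation "w <~> w'" := (equivalent Delta_move w w') (at level 70).

(** The triangle of [c], of the arrow of [x] and of [n], when [c] goes from its
    first to its second place: it is acyclic, so this is R3. *)
Lemma eqv_swap_over e c x n t : perm_eq (holes t) (iota 0 3) ->
  let tn := arrow_tail n (conj_sign x) in
  let z := exchange (e == conj_sign x) (other_end x) (arrow_head n (conj_sign x)) in
  plug t [:: [:: tn; arrow_tail c e]; [:: x; arrow_head c e]; z.1] <~>
  plug t [:: [:: arrow_tail c e; tn]; [:: arrow_head c e; x]; z.2].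
Proof.
case: x => [[j k] s] ht tn z.
pose px := exchange true tn (arrow_tail c e).
pose py := exchange true (j, k, s) (arrow_head c e).
have rep := replace_plug3 px py z ht.
case: k @tn @z @px @py rep; rewrite /conj_sign /=; last first.
  rewrite addbF => rep.
  apply: (@eqv_R3 Delta_move c j n e s s true false (e == s)); last first.
    by rewrite (exchangeC false).
  by case: (e); case: (s).
rewrite addbT => rep.
apply: (@eqv_R3 Delta_move n j c (~~ s) s e false (e != ~~ s) true); last first.
  apply: replace_perm rep; rewrite (exchangeC false) (exchangeC (e != ~~ s)) negbK.
  exact: perm_swap23.
by case: (e); case: (s).
Qed.

(** For the reversed arrow [c] the triangle is cyclic if [x] is a head, and the move
    is then Delta; if [x] is a tail, it is still acyclic. *)
Lemma eqv_swap_under e c x n t : perm_eq (holes t) (iota 0 3) ->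
  let tn := arrow_tail n (conj_sign x) in
  let z := exchange (e == conj_sign x) (other_end x) (arrow_head n (conj_sign x)) in
  plug t [:: [:: tn; arrow_head c (~~ e)]; [:: x; arrow_tail c (~~ e)]; z.1] <~>
  plug t [:: [:: arrow_head c (~~ e); tn]; [:: arrow_tail c (~~ e); x]; z.2].
Proof.
case: x => [[j k] s] ht tn z.
pose px := exchange true tn (arrow_head c (~~ e)).
pose py := exchange true (j, k, s) (arrow_tail c (~~ e)).
have rep := replace_plug3 px py z ht.
case: k @tn @z @px @py rep; rewrite /conj_sign /=; last first.
  rewrite addbF => rep.
  apply: (@eqv_R3 Delta_move c n j (~~ e) s s true false (e != s)); last first.
    apply: replace_perm rep; rewrite (exchangeC false) (exchangeC (e != s)) negbK.
    exact: perm_swap12.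
  by case: (e); case: (s).
rewrite addbT => rep.
apply: (@eqv_Delta c n j (~~ e) (~~ s) s true false (e != ~~ s)); last first.
  apply: replace_perm rep; rewrite (exchangeC false) (exchangeC (e != ~~ s)) negbK.
  exact: perm_swap12.
by case: (e); case: (s).
Qed.

Section Rotation.

Variables (e : bool) (c : nat) (x : endpoint) (n n' : nat) (u v r : seq endpoint).

Let o := other_end x.
Let s := conj_sign x.
Let z := flanked e x n n'.
Let start := if e == s then [:: o; arrow_head n s; arrow_head n' (~~ s)]
             else [:: arrow_head n' (~~ s); arrow_head n s; o].
Let outer := arrow_tail n' (~~ s).

(** The pair [n], [n'] is created with both tails before the endpoint [y1] and
    both heads on the same side of the other end of [x]; the side depends on the
    signs so that the sign conditions of R3 and Delta hold. *)
Lemma eqv_insert_conj y1 y2 :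
    n \notin labels (u ++ y1 :: v ++ [:: x, y2 & r]) ->
    n' \notin labels (u ++ y1 :: v ++ [:: x, y2 & r]) -> n != n' ->
    count_mem o u + count_mem o v + count_mem o r = 1 ->
  u ++ y1 :: v ++ [:: x, y2 & r] <~>
  subst o start u ++ [:: outer, arrow_tail n s, y1 & subst o start v ++
    [:: x, y2 & subst o start r]].
Proof.
move=> nW n'W nn' cnt.
pose z0 : context := if e == s then [:: inl o; inr 1] else [:: inr 1; inl o].
pose t := punch o z0 u ++ [:: inr 0, inl y1 & punch o z0 v ++
  [:: inl x, inl y2 & punch o z0 r]].
have ht : perm_eq (holes t) (iota 0 2).
  have hz : holes z0 = [:: 1] by rewrite /z0; case: (e == s).
  rewrite /t !holesE hz.
  case: (count_mem o u) cnt => [|[|i]] //=; case: (count_mem o v) => [|[|j]] //=;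
  by case: (count_mem o r) => [|[|k]].
have := @eqv_R2_plug Delta_move false (e == s) n n' s t ht.
have -> : plug t [::] = u ++ y1 :: v ++ [:: x, y2 & r].
  by rewrite /t !plugE /z0; case: (e == s); rewrite /= !subst_id.
have ez ws : nth [::] ws 1 = portion (e == s) (arrow_head n s) (arrow_head n' (~~ s)) ->
    plug z0 ws = start.
  by rewrite /z0 /start; case: (e == s); rewrite !plugE => ->.
by rewrite /t !plugE !ez //; apply.
Qed.

Let context_at : context := if e == s then [:: inr 2; inl (arrow_head n' (~~ s))]
  else [:: inl (arrow_head n' (~~ s)); inr 2].
Let t : context := punch o context_at u ++ [:: inl outer, inr 0 &
  punch o context_at v ++ inr 1 :: punch o context_at r].
Let ze := exchange (e == s) o (arrow_head n s).

Lemma perm_holes_rotation :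
    count_mem o u + count_mem o v + count_mem o r = 1 ->
  perm_eq (holes t) (iota 0 3).
Proof.
have hz : holes context_at = [:: 2] by rewrite /context_at; case: (e == s).
rewrite /t !holesE hz.
case: (count_mem o u) => [|[|i]] //=; case: (count_mem o v) => [|[|j]] //=;
by case: (count_mem o r) => [|[|k]].
Qed.

Lemma plug_rotation_start a b :
  plug t [:: a; b; ze.1] =
  subst o start u ++ outer :: a ++ subst o start v ++ b ++ subst o start r.
Proof.
have ez : plug context_at [:: a; b; ze.1] = start.
  by rewrite /context_at /start /ze; case: (e == s).
by rewrite /t !plugE ez.
Qed.

Lemma plug_rotation_end a b :
  plug t [:: a; b; ze.2] =
  subst o z u ++ outer :: a ++ subst o z v ++ b ++ subst o z r.
Proof.
have ez : plug context_at [:: a; b; ze.2] = z.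
  by rewrite /context_at /z /flanked /ze /o -/s; case: (e == s).
by rewrite /t !plugE ez.
Qed.

Hypothesis g : is_gauss (u ++ arrow_tail c e :: v ++ [:: x, arrow_head c e & r]).
Hypothesis nW :
  n \notin labels (u ++ arrow_tail c e :: v ++ [:: x, arrow_head c e & r]).
Hypothesis n'W :
  n' \notin labels (u ++ arrow_tail c e :: v ++ [:: x, arrow_head c e & r]).
Hypothesis nn' : n != n'.

Lemma count_rotation : count_mem o u + count_mem o v + count_mem o r = 1.
Proof.
have g2 : is_gauss (u ++ arrow_tail c e :: (v ++ [:: x]) ++ arrow_head c e :: r).
  by rewrite -catA.
have xin : x \in u ++ (v ++ [:: x]) ++ r by rewrite !(mem_cat, inE) eqxx !orbT.
have := count_other_end g2 xin; rewrite count_cat /= -/o.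
by rewrite [x == o]eq_sym (negPf (other_end_neq x)) !addn0.
Qed.

Lemma rotate_over :
  u ++ arrow_tail c e :: v ++ [:: x, arrow_head c e & r] <~>
  (subst o z u ++ [:: outer]) ++ arrow_tail c e :: (arrow_tail n s :: subst o z v) ++
    arrow_head c e :: x :: subst o z r.
Proof.
apply: eqv_trans (eqv_insert_conj nW n'W nn' count_rotation) _.
have := eqv_swap_over e c x n (perm_holes_rotation count_rotation).
by rewrite /= plug_rotation_start plug_rotation_end -catA.
Qed.

Lemma rotate_under :
  u ++ arrow_head c (~~ e) :: v ++ [:: x, arrow_tail c (~~ e) & r] <~>
  (subst o z u ++ [:: outer]) ++ arrow_head c (~~ e) ::
    (arrow_tail n s :: subst o z v) ++ arrow_tail c (~~ e) :: x :: subst o z r.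
Proof.
have same_labels : labels (u ++ arrow_head c (~~ e) :: v ++ [:: x, arrow_tail c (~~ e) & r]) =
    labels (u ++ arrow_tail c e :: v ++ [:: x, arrow_head c e & r]).
  by rewrite !labels_cat /= !labels_cat.
apply: eqv_trans (eqv_insert_conj _ _ nn' count_rotation) _; rewrite ?same_labels //.
have := eqv_swap_under e c x n (perm_holes_rotation count_rotation).
by rewrite /= plug_rotation_start plug_rotation_end -catA.
Qed.

End Rotation.

(** The two directions of [c] have lost [x] to the same word, so reversing [c] over
    what it encloses now is enough. *)
Lemma reversible_rotate e c u v x r :
    is_gauss (u ++ arrow_tail c e :: rcons v x ++ arrow_head c e :: r) ->
    (forall n n',
       n \notin labels (u ++ arrow_tail c e :: rcons v x ++ arrow_head c e :: r) ->
       n' \notin labels (u ++ arrow_tail c e :: rcons v x ++ arrow_head c e :: r) ->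
       n != n' ->
       reversible Delta_move true e (arrow_tail n (conj_sign x) ::
         subst (other_end x) (flanked e x n n') v)) ->
  u ++ arrow_tail c e :: rcons v x ++ arrow_head c e :: r <~>
  u ++ arrow_head c (~~ e) :: rcons v x ++ arrow_tail c (~~ e) :: r.
Proof.
rewrite -cats1 -!catA => g rev.
have [n [n' [nW n'W nn']]] :=
  fresh_labels (labels (u ++ arrow_tail c e :: v ++ [:: x] ++ arrow_head c e :: r)).
apply: eqv_trans (rotate_over g nW n'W nn') _.
apply: eqv_trans _ (eqv_sym (rotate_under g nW n'W nn')).
exact: rev.
Qed.

(** * Termination for Delta *)

(** The cost of pushing [x] out of an arrow of sign [e] enclosing [S].  If the other
    end of [x] is not enclosed, [x] just becomes a tail.  Otherwise this other end
    remains with cost 1, between the heads of [n'], with cost 1 since its tail is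
    not enclosed, and of [n].  A head whose sign differs from [e] costs less since
    then the arrow [n] becomes a kink over tails and disappears. *)
Definition weight_in (S : seq endpoint) (e : bool) (x : endpoint) : nat :=
  if other_end x \in S then (if x.1.2 && (x.2 != e) then 3 else 6) else 1.

Definition weight (S : seq endpoint) (e : bool) (r : seq endpoint) : nat :=
  sumn [seq weight_in S e x | x <- r].

Lemma weight_cat S e r1 r2 : weight S e (r1 ++ r2) = weight S e r1 + weight S e r2.
Proof. by rewrite /weight map_cat sumn_cat. Qed.

Lemma weight_cons S e x r : weight S e (x :: r) = weight_in S e x + weight S e r.
Proof. by []. Qed.

Lemma weight_in_out S e x : other_end x \notin S -> weight_in S e x = 1.
Proof. by rewrite /weight_in => /negPf->. Qed.

Lemma weight_in_gt0 S e x : 0 < weight_in S e x.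
Proof. by rewrite /weight_in; case: ifP => //; case: ifP. Qed.

Lemma weight_in_le6 S e x : weight_in S e x <= 6.
Proof. by rewrite /weight_in; case: ifP => //; case: ifP. Qed.

Lemma leq_weight S S' e r :
    {in r, forall x, other_end x \in S' -> other_end x \in S} ->
  weight S' e r <= weight S e r.
Proof.
elim: r => // x r IH sub; rewrite !weight_cons leq_add ?IH //; last first.
  by move=> y yr; apply: sub; rewrite inE yr orbT.
rewrite /weight_in; have := sub x (mem_head _ _); case: (_ \in S') => [->|_] //.
by case: ifP => //; case: ifP.
Qed.

Lemma weight_pair S e x : x \in S -> other_end x \in S ->
  9 <= weight_in S e x + weight_in S e (other_end x).
Proof.
rewrite /weight_in other_endK => -> ->.
by case: x => [[a []] s] /=; case: (s != e).
Qed.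

Lemma reversible_move_tail e k1 a s k2 r :
    all_tails k2 ->
    reversible Delta_move true e (k1 ++ k2 ++ arrow_tail a s :: r) ->
  reversible Delta_move true e (k1 ++ arrow_tail a s :: k2 ++ r).
Proof.
move=> k2t rev c u w.
have move_in y y' : u ++ y :: (k1 ++ arrow_tail a s :: k2 ++ r) ++ y' :: w <~>
    u ++ y :: (k1 ++ k2 ++ arrow_tail a s :: r) ++ y' :: w.
  have := eqv_tail_past_tails Delta_move a s (u ++ y :: k1) (r ++ y' :: w) k2t.
  by rewrite -!catA /= -!catA.
apply: eqv_trans (move_in _ _) _; apply: eqv_trans (rev c u w) _.
exact/eqv_sym/move_in.
Qed.

Lemma reversible_drop_over_tails e a s k r :
    all_tails k ->
    reversible Delta_move true e (k ++ r) ->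
  reversible Delta_move true e (arrow_tail a s :: k ++ arrow_head a s :: r).
Proof.
move=> kt rev c u w; apply: eqv_gauss; first exact: is_gauss_reverse.
move=> g.
have drop y y' : is_gauss (u ++ y :: (arrow_tail a s :: k ++ arrow_head a s :: r) ++ y' :: w) ->
    u ++ y :: (arrow_tail a s :: k ++ arrow_head a s :: r) ++ y' :: w <~>
    u ++ y :: (k ++ r) ++ y' :: w.
  have := @eqv_drop_over_tails Delta_move a s (u ++ [:: y]) k (r ++ y' :: w) kt.
  by rewrite -!catA /= -!catA.
apply: eqv_trans (drop _ _ g) _; apply: eqv_trans (rev c u w) _.
by apply/eqv_sym/drop; rewrite -(is_gauss_reverse c e).
Qed.

(** The enclosed word is [k ++ r], where [k] consists of tails already in their final
    form and [r] is processed from its end, by induction on its weight.  Let [x] be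
    the last endpoint of [r] and [o] its other end.

    If [o] is not enclosed, [r] loses [x].  If [o] is in [r], the weights of [x] and
    [o], at least 9 together, are replaced by at most 1 + 1 + 6.  If [o] is in
    [k], it is a tail, and is first carried to the end of [k].  If moreover the sign
    of [x] is [e], then 6 is replaced by 1 + 1 + 3, as the head of [n] has the sign
    opposite to [e].  If it is not [e], then the head of [n] comes first among the
    three endpoints, so that [n] encloses only tails and is deleted: 3 is replaced
    by 1 + 1. *)
Lemma reversible_Delta_weight e N k r : all_tails k ->
  weight (k ++ r) e r < N -> reversible Delta_move true e (k ++ r).
Proof.
elim: N k r => // N IH k r; case/lastP: r => [|r x].
  by rewrite cats0 => kt _; apply: reversible_over_tails.
move=> kt; rewrite ltnS; set S := k ++ rcons r x; set o := other_end x.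
have rotate k1 : {subset S <= k1 ++ rcons r x} ->
   (forall n n', n != n' -> {in S, forall y, y.1.1 \notin [:: n; n']} ->
      uniq (k1 ++ rcons r x) ->
      reversible Delta_move true e (arrow_tail n (conj_sign x) ::
         subst o (flanked e x n n') (k1 ++ r))) ->
   reversible Delta_move true e (k1 ++ rcons r x).
  move=> kS rev c u w; apply: eqv_gauss => [|g]; first exact: is_gauss_reverse.
  have uS : uniq (k1 ++ rcons r x).
    move: (is_gauss_uniq g); rewrite cat_uniq => /and3P[_ _]; rewrite cons_uniq.
    by case/andP=> _; rewrite cat_uniq => /and3P[].
  rewrite -rcons_cat in g *; apply: reversible_rotate (g) _ => n n' nW n'W nn'.
  apply: rev => // y /kS yS; rewrite !inE negb_or.
  have yW : y.1.1 \in labels (u ++ arrow_tail c e :: rcons (k1 ++ r) x ++ arrow_head c e :: w).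
    by apply/mapP; exists y => //; rewrite mem_cat inE mem_cat rcons_cat yS !orbT.
  by rewrite !(contraTneq _ yW) // => ->.
have xS : x \in S by rewrite mem_cat mem_rcons mem_head orbT.
pose tail n := arrow_tail n (conj_sign x).
pose head n := arrow_head n (conj_sign x).
pose head' n' := arrow_head n' (~~ conj_sign x).
(* Everything enclosed once [x] is out. *)
pose inner n n' y := (y \in S) && (y != x) || (y \in [:: tail n; head n; head' n']).
have old n n' : uniq S -> all (inner n n') (k ++ r).
  rewrite /S -rcons_cat rcons_uniq => /andP[xkr _]; apply/allP => y ykr.
  by rewrite /inner /S -rcons_cat mem_rcons inE ykr orbT (contraTneq _ ykr) // => ->.
have inner_o n n' : o \in S -> inner n n' o.
  by move=> oS; rewrite /inner oS other_end_neq.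
have inner_z n n' : o \in S -> all (inner n n') (flanked e x n n').
  move=> /(inner_o n n') io; rewrite /flanked.
  have hn : inner n n' (head n) by rewrite /inner !inE eqxx !orbT.
  have hn' : inner n n' (head' n') by rewrite /inner !inE eqxx !orbT.
  by case: ifP => _; rewrite /= hn hn' io.
(* The new arrows do not raise the weight of the old endpoints. *)
have smaller n n' S' r' : {in S, forall y, y.1.1 \notin [:: n; n']} ->
    all (inner n n') S' -> {subset r' <= S} -> weight S' e r' <= weight S e r'.
  move=> newS /allP inS r'S; apply: leq_weight => y /r'S yS /inS.
  case/orP=> [/andP[]//|ynew]; have := newS y yS.
  rewrite -[y.1.1]/((other_end y).1.1).
  by move: ynew; rewrite !inE => /or3P[] /eqP->; rewrite ?eqxx ?orbT.
have weight_z n n' S' : n != n' -> {in S, forall y, y.1.1 \notin [:: n; n']} ->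
    all (inner n n') S' ->
    weight S' e (flanked e x n n') = weight_in S' e (head n) + 2.
  move=> nn' newS /allP inS.
  have wo : weight_in S' e o = 1.
    apply: weight_in_out; rewrite other_endK; apply/negP=> /inS.
    rewrite /inner eqxx andbF /= => xnew; have := newS x xS.
    by move: xnew; rewrite !inE => /or3P[] /eqP->; rewrite ?eqxx ?orbT.
  have wn' : weight_in S' e (head' n') = 1.
    apply: weight_in_out; apply/negP=> /inS /orP[/andP[/newS]|].
      by rewrite !inE eqxx orbT.
    by rewrite !inE !xpair_eqE /= eq_sym (negPf nn') !andbF.
  rewrite /flanked -/o -/(head n) -/(head' n').
  by case: ifP => _; rewrite /weight /= wo wn'; lia.
have weight_rcons : weight S e (rcons r x) = weight S e r + weight_in S e x.
  by rewrite -cats1 weight_cat weight_cons addn0.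
have rS : {subset r <= S} by move=> y yr; rewrite /S mem_cat mem_rcons inE yr !orbT.
have inner_tail n n' : inner n n' (tail n) by rewrite /inner mem_head orbT.
have inner_head' n n' : inner n n' (head' n') by rewrite /inner !inE eqxx !orbT.
rewrite weight_rcons; have [ok|ok] := boolP (o \in k).
  have oS : o \in S by rewrite mem_cat ok.
  have [k1 [k2 ek]] : exists k1 k2, k = k1 ++ o :: k2.
    by case/splitPr: ok => k1 k2; exists k1, k2.
  have [kt' ot] : all_tails (k1 ++ k2) /\ ~~ o.1.2.
    by move: kt; rewrite ek !all_cat /= => /and3P[-> ->].
  have [j [b [oE xE]]] : exists j b, o = arrow_tail j b /\ x = arrow_head j b.
    move: ot (other_endK x); rewrite -/o; case: (o) => [[j []] b] // _ <-.
    by exists j, b.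
  have xe : conj_sign x = ~~ b by rewrite xE /conj_sign /= addbT.
  move=> lt_N.
  have -> : S = k1 ++ arrow_tail j b :: k2 ++ rcons r x.
    by rewrite /S ek -catA -oE.
  apply: reversible_move_tail.
    by move: kt'; rewrite all_cat => /andP[].
  have -> : k1 ++ k2 ++ arrow_tail j b :: rcons r x = (k1 ++ k2 ++ [:: o]) ++ rcons r x.
    by rewrite -!catA oE.
  have perm_S : perm_eq ((k1 ++ k2 ++ [:: o]) ++ rcons r x) S.
    by rewrite /S ek perm_cat2r perm_cat2l (permEl (perm_catC k2 _)).
  apply: rotate => [y|n n' nn' newS]; first by rewrite (perm_mem perm_S).
  rewrite (perm_uniq perm_S) => uS.
  have [[ok1 ok2] orr] : (o \notin k1 /\ o \notin k2) /\ o \notin r.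
    have perm_o : perm_eq S (o :: (k1 ++ k2) ++ rcons r x).
      by rewrite /S ek -!catA (permEl (perm_catCA k1 [:: o] _)).
    move: uS; rewrite (perm_uniq perm_o) /= !mem_cat mem_rcons inE !negb_or.
    by case/andP=> /andP[/andP[-> ->] /andP[_ ->]].
  have -> : subst o (flanked e x n n') ((k1 ++ k2 ++ [:: o]) ++ r) =
      (k1 ++ k2) ++ flanked e x n n' ++ r.
    rewrite !subst_cat !(subst_notin _ ok1, subst_notin _ ok2, subst_notin _ orr).
    by rewrite /subst /= eqxx cats0 -!catA.
  have in_kr : all (inner n n') (k1 ++ k2) /\ all (inner n n') r.
    move: (old n n' uS); rewrite ek !all_cat /=.
    by case/andP=> /and3P[-> _ ->] ->.
  case eqe : (e == conj_sign x).
    rewrite /flanked eqe -/o.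
    apply: reversible_drop_over_tails => //.
    apply: (IH (k1 ++ k2) (o :: head' n' :: r)) => //; apply: leq_trans lt_N.
    set S' := _ ++ _; have inS' : all (inner n n') S'.
      by rewrite /S' all_cat /= inner_o // inner_head'; case: in_kr => -> ->.
    have := weight_z n n' S' nn' newS inS'.
    have := smaller n n' S' r newS inS' rS.
    have := weight_in_gt0 S' e (head n).
    rewrite /flanked eqe -/o !weight_cons.
    have : 3 <= weight_in S e x by rewrite /weight_in -/o oS; case: ifP.
    rewrite /weight /=; move: (sumn _) (sumn _) (weight_in S e x).
    move: (weight_in S' e (head n)) (weight_in S' e o) (weight_in S' e (head' n')).
    by clear; lia.
  apply: (IH (tail n :: k1 ++ k2)) => //; apply: leq_trans lt_N.
  set S' := _ ++ _; have inS' : all (inner n n') S'.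
    by rewrite /S' /= inner_tail !all_cat inner_z //; case: in_kr => + ->; rewrite all_cat => ->.
  have := weight_z n n' S' nn' newS inS'.
  have := smaller n n' S' r newS inS' rS.
  have : weight_in S' e (head n) <= 3.
    by rewrite /weight_in /= eq_sym eqe; case: ifP.
  have : weight_in S e x = 6.
    by rewrite /weight_in -/o oS; move: eqe; rewrite xe xE /=; case: (e); case: (b).
  rewrite weight_cat; move: (weight_in S e x) (weight_in S' e (head n)).
  move: (weight S e r) (weight S' e r) (weight S' e (flanked e x n n')).
  by clear; lia.
have [orr|orr] := boolP (o \in r) => lt_N; last first.
  apply: (rotate k) => // n n' nn' newS uS.
  rewrite subst_cat (subst_notin _ ok) (subst_notin _ orr).
  apply: (IH (tail n :: k) r kt); apply: leq_trans lt_N.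
  rewrite -addn1 leq_add ?weight_in_gt0 //.
  by apply: (smaller n n') => //; rewrite /= old // inner_tail.
apply: (rotate k) => // n n' nn' newS uS.
have {rotate IH} := IH (tail n :: k) (subst o (flanked e x n n') r) kt.
rewrite subst_cat (subst_notin _ ok); apply; apply: leq_trans lt_N.
have oS : o \in S by apply: rS.
have [r1 [r2 er]] : exists r1 r2, r = r1 ++ o :: r2.
  by case/splitPr: orr => r1 r2; exists r1, r2.
have [o1 o2] : o \notin r1 /\ o \notin r2.
  move: uS; rewrite -cats1 cat_uniq er => /and3P[_ _].
  rewrite !cat_uniq /= => /andP[/and3P[_ + /andP[+ _]] _].
  by rewrite negb_or => /andP[].
have -> : subst o (flanked e x n n') r = r1 ++ flanked e x n n' ++ r2.
  by rewrite er -cat1s !subst_cat !(subst_notin _ o1, subst_notin _ o2) /subst /= eqxx cats0.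
set S' := _ ++ _; have inS' : all (inner n n') S'.
  move: (old n n' uS); rewrite /S' er !all_cat /= inner_tail inner_z //.
  by case/and4P=> -> -> _ ->.
have r1S : {subset r1 <= S} by move=> y yr; apply: rS; rewrite er mem_cat yr.
have r2S : {subset r2 <= S} by move=> y yr; apply: rS; rewrite er mem_cat inE yr !orbT.
have := smaller n n' S' r1 newS inS' r1S; have := smaller n n' S' r2 newS inS' r2S.
have := weight_pair e xS oS; have := weight_in_le6 S' e (head n).
rewrite er !weight_cat weight_cons (weight_z n n') // -/o.
move: (weight_in S e x) (weight_in S e o) (weight_in S' e (head n)).
move: (weight S e r1) (weight S' e r1) (weight S e r2) (weight S' e r2).
by clear; lia.
Qed.

Lemma reversible_Delta e v : reversible Delta_move true e v.
Proof. exact: (@reversible_Delta_weight e _ [::] v isT (ltnSn _)). Qed.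

(** * The theorem *)

Lemma unknotting_of_tails_pass_heads mu :
  tails_pass_heads mu -> unknotting OneInterval mu.
Proof.
move=> pass [w g]; have [_ triv] := trivial_of_tails_pass_heads pass g.
exact: triv.
Qed.

(** With a fixed base point, a sequence of moves on the interval is also one on the
    circle. *)
Lemma unknotting_circle mu : unknotting OneInterval mu -> unknotting OneCircle mu.
Proof.
move=> unk D; elim: {D}(unk D) => [D D' m|D|D D' _|D D' D'' _ IH _].
- apply: rst_step; case: m => [[f f_inj eD']|m|m].
  + by constructor 1; exists f => //; exists 0; rewrite rot0.
  + by constructor 2.
  + by constructor 3.
- exact: rst_refl.
- exact: rst_sym.
- exact: rst_trans IH.
Qed.

Theorem corollary2p11 :
  [/\ unknotting OneInterval Delta_move, unknotting OneInterval BP_move,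
      unknotting OneInterval F_move, unknotting OneInterval VC_move
    & unknotting OneInterval wBP_move] /\
  [/\ unknotting OneCircle Delta_move, unknotting OneCircle BP_move,
      unknotting OneCircle F_move, unknotting OneCircle VC_move
    & unknotting OneCircle wBP_move].
Proof.
have interval : [/\ unknotting OneInterval Delta_move, unknotting OneInterval BP_move,
      unknotting OneInterval F_move, unknotting OneInterval VC_move
    & unknotting OneInterval wBP_move].
  split; apply: unknotting_of_tails_pass_heads.
  - exact: tails_pass_heads_of_reversible reversible_Delta.
  - exact: tails_pass_heads_of_reversible (reversible_of_triangles reverses_triangles_BP).
  - exact: tails_pass_heads_F.
  - exact: tails_pass_heads_of_reversible reversible_VC.
  - exact: tails_pass_heads_of_reversible (reversible_of_triangles reverses_triangles_wBP).
by split=> //; case: interval; split; apply: unknotting_circle.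
Qed.
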